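(* Let $C,D\in\mathbb{R}$ and let $$R(z;C,D)=\frac{1+z\left[\left(\frac16+4C+\frac12D\right)+\left(\frac23-8C+2D\right)G(z)\right]+z^2\left[C+D\,G(z)\right]}{1-\left(\frac16+4C-\frac52D\right)z-\left(\frac12D-C\right)z^2},\qquad G(z)=\frac{1+\frac z4+\frac{z^2}{48}}{1-\frac z4+\frac{z^2}{48}},$$ for complex $z$. Then $$\lim_{\substack{|z|\to\infty\\ \operatorname{Re}(z)\le 0}}R(z;C,D)=0$$ holds if and only if $C=-D\neq 0$.
   Context: $R(z;C,D)$ is the amplification factor (stability function) of the implicit two-stage fourth-order scheme with real parameters $C,D$, applied to the scalar test equation $u_t=\lambda u$ with $z=\lambda\Delta t$: $u^{n+1/2}=G(z)u^n$ and $u^{n+1}=R(z;C,D)u^n$. The limit is taken over complex $z$ in the closed left half-plane with $|z|\to\infty$. *)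

(* Defs.v *)
From Stdlib Require Import Reals Lra.
From Coquelicot Require Import Coquelicot.

Open Scope C_scope.

Definition stage_factor (z : C) : C :=
  (1 + z / 4 + z ^ 2 / 48) / (1 - z / 4 + z ^ 2 / 48).

(* Division in [C] is total, so this function has an unspecified value at its
   (finitely many) poles; this does not affect limits at infinity. *)
Definition stability_function (c d : R) (z : C) : C :=
  (1 + z * ((1 / 6 + 4 * c + 1 / 2 * d)
            + (2 / 3 - 8 * c + 2 * d) * stage_factor z)
     + z ^ 2 * (c + d * stage_factor z))
  / (1 - (1 / 6 + 4 * c - 5 / 2 * d) * z - (1 / 2 * d - c) * z ^ 2).

(* The filter of neighbourhoods of infinity: |z| tends to infinity. *)
Definition C_infinity (P : C -> Prop) : Prop :=
  exists M : R, forall z : C, (M < Cmod z)%R -> P z.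

Definition left_half_plane_infinity : (C -> Prop) -> Prop :=
  within (fun z : C => (Re z <= 0)%R) C_infinity.

Global Instance C_infinity_filter : Filter C_infinity.
Proof.
constructor.
- now exists 0%R.
- intros P Q [M HP] [N HQ]; exists (Rmax M N); intros z Hz; split.
  + apply HP; apply Rle_lt_trans with (2 := Hz); apply Rmax_l.
  + apply HQ; apply Rle_lt_trans with (2 := Hz); apply Rmax_r.
- intros P Q HPQ [M HP]; exists M; auto.
Qed.

Global Instance left_half_plane_infinity_proper :
  ProperFilter left_half_plane_infinity.
Proof.
split.
- intros P [M HP]; exists (RtoC (- (Rabs M + 1))).
  apply HP; [rewrite Cmod_R, Rabs_Ropp, Rabs_pos_eq|simpl];
    pose proof (Rabs_pos M); pose proof (Rle_abs M); lra.
- apply within_filter, C_infinity_filter.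
Qed.

(* Main.v *)
(** With [w = 1/z] and [G -> 1] at infinity, multiplying the numerator and the
    denominator of [R] by [w^2] gives [R = N/E] with [N -> c + d] and
    [E -> c - d/2].  If [R -> 0] then [N = R E -> 0], so [c = -d]; and if
    [c = d = 0], then [z N -> 1/6 + 2/3 <> 0] while [z E -> -1/6], so [R]
    does not tend to [0].  Conversely [c = -d <> 0] gives [N -> 0] and
    [E -> -3d/2 <> 0]. *)

Require Import Defs.
From Stdlib Require Import Reals Lra.
From Coquelicot Require Import Coquelicot.

Local Open Scope C_scope.

(** The default uniform structure on [C] is that of a product, with box-shaped balls. By [locally_C]
    it has the same neighbourhoods as the one given by [Cmod], where the claim is the metric form of
    a limit. *)
Lemma filterlim_C_iff {T : Type} {F : (T -> Prop) -> Prop} {FF : Filter F}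
  (f : T -> C) (l : C) :
  filterlim f F (locally l) <->
  forall eps : posreal, F (fun x => (Cmod (f x - l) < eps)%R).
Proof.
rewrite <- (filterlim_locally (U := AbsRing_UniformSpace C_AbsRing) f l).
split; intros H P HP; apply H; now apply locally_C.
Qed.

Lemma filterlim_Cplus {T : Type} {F : (T -> Prop) -> Prop} {FF : Filter F}
  (f g : T -> C) (l m : C) :
  filterlim f F (locally l) -> filterlim g F (locally m) ->
  filterlim (fun x => f x + g x) F (locally (l + m)).
Proof.
intros Hf Hg; apply (filterlim_comp_2 _ _ _ Hf Hg).
exact (filterlim_plus (V := C_NormedModule) l m).
Qed.

Lemma filterlim_Cmult {T : Type} {F : (T -> Prop) -> Prop} {FF : Filter F}
  (f g : T -> C) (l m : C) :
  filterlim f F (locally l) -> filterlim g F (locally m) ->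
  filterlim (fun x => f x * g x) F (locally (l * m)).
Proof.
intros Hf Hg.
(* [filterlim_mult] speaks of the topology of the modulus, so all three limits are carried over to
   it. *)
assert (L : forall (h : T -> C) (k : C), filterlim h F (locally k) <->
  filterlim h F (locally (T := AbsRing_UniformSpace C_AbsRing) k)).
{ intros h k; split; intros H P HP; apply H; now apply locally_C. }
apply L; apply L in Hf; apply L in Hg.
apply (filterlim_comp_2 _ _ _ Hf Hg), (filterlim_mult (K := C_AbsRing)).
Qed.

Lemma filterlim_Cminus {T : Type} {F : (T -> Prop) -> Prop} {FF : Filter F}
  (f g : T -> C) (l m : C) :
  filterlim f F (locally l) -> filterlim g F (locally m) ->
  filterlim (fun x => f x - g x) F (locally (l - m)).
Proof.
intros Hf Hg; apply filterlim_Cplus; [exact Hf|].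
apply (filterlim_comp _ _ _ g Copp _ _ _ Hg).
exact (filterlim_opp (V := C_NormedModule) m).
Qed.

(** Within distance [Cmod l] of [l] there is no zero. *)
Lemma filterlim_C_neq_0 {T : Type} {F : (T -> Prop) -> Prop} {FF : Filter F}
  (f : T -> C) (l : C) :
  filterlim f F (locally l) -> l <> 0 -> F (fun x => f x <> 0).
Proof.
intros Hf Hl; apply Cmod_gt_0 in Hl.
generalize (proj1 (filterlim_C_iff f l) Hf (mkposreal _ Hl)).
apply filter_imp; intros x Hx E; simpl in Hx; rewrite E in Hx.
replace (0 - l) with (- l) in Hx by ring; rewrite Cmod_opp in Hx; lra.
Qed.

Lemma filterlim_Cinv {T : Type} {F : (T -> Prop) -> Prop} {FF : Filter F}
  (f : T -> C) (l : C) :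
  filterlim f F (locally l) -> l <> 0 ->
  filterlim (fun x => / f x) F (locally (/ l)).
Proof.
intros Hf Hl; pose proof (proj1 (Cmod_gt_0 l) Hl) as Pl.
apply filterlim_C_iff; intros eps.
pose proof (cond_pos eps) as Pe.
(* The estimate rests on |1/f - 1/l| = |f - l| / (|f| |l|). The first radius keeps |f| above |l|/2;
   the second then bounds the quotient by [eps]. *)
assert (P1 : (0 < Cmod l / 2)%R) by lra.
assert (P2 : (0 < eps * (Cmod l * Cmod l) / 2)%R) by
  (apply Rdiv_lt_0_compat; [repeat apply Rmult_lt_0_compat|]; lra).
generalize (filter_and _ _
  (filter_and _ _ (proj1 (filterlim_C_iff f l) Hf (mkposreal _ P1))
                  (proj1 (filterlim_C_iff f l) Hf (mkposreal _ P2)))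
  (filterlim_C_neq_0 f l Hf Hl)).
apply filter_imp; simpl; intros x [[H1 H2] H3].
assert (H4 : (Cmod l / 2 < Cmod (f x))%R).
{ pose proof (Cmod_triangle (f x) (- (f x - l))) as H.
  replace (f x + - (f x - l)) with l in H by ring.
  rewrite Cmod_opp in H; lra. }
replace (/ f x - / l) with (- (f x - l) / (f x * l)) by (field; auto).
rewrite Cmod_div by now apply Cmult_neq_0.
rewrite Cmod_opp, Cmod_mult.
apply Rlt_div_l; [apply Rmult_lt_0_compat; lra|].
apply Rlt_trans with (1 := H2).
replace (eps * (Cmod l * Cmod l) / 2)%R with (eps * (Cmod l / 2 * Cmod l))%R
  by field.
apply Rmult_lt_compat_l, Rmult_lt_compat_r; lra.
Qed.

Lemma filterlim_Cinv_infinity :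
  filterlim Cinv left_half_plane_infinity (locally (RtoC 0)).
Proof.
apply filterlim_C_iff; intros [eps Pe]; exists (/ eps)%R; intros z Hz _; simpl.
assert (Pi := Rinv_0_lt_compat _ Pe).
assert (z <> 0) by (apply Cmod_gt_0; lra).
replace (/ z - 0) with (/ z) by ring.
rewrite Cmod_inv by assumption.
rewrite <- (Rinv_inv eps); apply Rinv_lt_contravar; [|exact Hz].
apply Rmult_lt_0_compat; lra.
Qed.

Lemma left_half_plane_infinity_neq_0 :
  left_half_plane_infinity (fun z => z <> 0).
Proof.
exists 0%R; intros z Hz _; now apply Cmod_gt_0.
Qed.

(** Side conditions of [field] about numerals are settled by comparing real parts. *)
Ltac cfield :=
  field; repeat split; auto;
  try (let H := fresh in intros H; apply (f_equal Re) in H; simpl in H; lra).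

(* The match is syntactic: applying the three rules blindly lets unification
   unfold the complex operations to real ones. *)
Ltac climit :=
  try assumption;
  lazymatch goal with
  | |- filterlim (fun _ => ?k) _ _ => apply filterlim_const
  | |- filterlim (fun x => Cminus _ _) _ _ => apply filterlim_Cminus; climit
  | |- filterlim (fun x => Cplus _ _) _ _ => apply filterlim_Cplus; climit
  | |- filterlim (fun x => Cmult _ _) _ _ => apply filterlim_Cmult; climit
  | |- _ => idtac
  end.

(** Dividing both quadratics by z^2 turns them into polynomials in 1/z with the same constant term
    1/48. *)
Lemma filterlim_stage_factor :
  filterlim stage_factor left_half_plane_infinity (locally (RtoC 1)).
Proof.
pose proof filterlim_Cinv_infinity as Hw.
assert (H48 : / 48 <> 0) by (intros H; apply (f_equal Re) in H; simpl in H; lra).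
assert (HD : filterlim (fun z => / z * / z - / 4 * / z + / 48)
  left_half_plane_infinity (locally (/ 48))).
(* The limit is put in the shape that the limit rules produce, with 0 for [/ z]; the same device
   recurs below. *)
{ replace (locally (/ 48)) with (locally (0 * 0 - / 4 * 0 + / 48))
    by (f_equal; ring).
  climit. }
apply filterlim_ext_loc with
  (fun z => (/ z * / z + / 4 * / z + / 48) * / (/ z * / z - / 4 * / z + / 48)).
- generalize (filter_and _ _ left_half_plane_infinity_neq_0
    (filterlim_C_neq_0 _ _ HD H48)).
  apply filter_imp; intros z [Hz HE]; unfold stage_factor.
  replace (1 + z / 4 + z ^ 2 / 48)
    with (z ^ 2 * (/ z * / z + / 4 * / z + / 48)) by cfield.
  replace (1 - z / 4 + z ^ 2 / 48)
    with (z ^ 2 * (/ z * / z - / 4 * / z + / 48)) by cfield.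
  (* Naming both factors keeps [field] from expanding them, so that [HE] matches its side
     condition. *)
  set (u := _ + / 48) in *. set (v := _ + / 48) in *.
  cfield.
- replace (RtoC 1) with ((0 * 0 + / 4 * 0 + / 48) * / / 48) by cfield.
  climit; now apply filterlim_Cinv.
Qed.

(** Divided by the highest power of z that is present, the polynomial has limit -b, -a or 1, which
    is nonzero in each case. This covers the denominator of [stability_function] for all [c] and
    [d]. *)
Lemma quadratic_neq_0_infinity (a b : C) :
  left_half_plane_infinity (fun z => 1 - a * z - b * z ^ 2 <> 0).
Proof.
pose proof filterlim_Cinv_infinity as Hw.
destruct (Ceq_dec b 0) as [Hb|Hb]; [destruct (Ceq_dec a 0) as [Ha|Ha]|].
- apply filter_forall; intros z; subst.
  replace (1 - 0 * z - 0 * z ^ 2) with (RtoC 1) by ring.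
  apply C1_nz.
- assert (H : filterlim (fun z => / z - a) left_half_plane_infinity
    (locally (0 - a))) by climit.
  apply filterlim_C_neq_0 in H.
  2: { intros E; apply Ha; replace a with (- (0 - a)) by ring; rewrite E; ring. }
  generalize (filter_and _ _ left_half_plane_infinity_neq_0 H).
  apply filter_imp; intros z [Hz Hn]; subst b.
  replace (1 - a * z - 0 * z ^ 2) with (z * (/ z - a)) by cfield.
  now apply Cmult_neq_0.
- assert (H : filterlim (fun z => / z * / z - a * / z - b)
    left_half_plane_infinity (locally (0 * 0 - a * 0 - b))) by climit.
  apply filterlim_C_neq_0 in H.
  2: { intros E; apply Hb.
       replace b with (- (0 * 0 - a * 0 - b)) by ring; rewrite E; ring. }
  generalize (filter_and _ _ left_half_plane_infinity_neq_0 H).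
  apply filter_imp; intros z [Hz Hn].
  replace (1 - a * z - b * z ^ 2) with (z * z * (/ z * / z - a * / z - b))
    by cfield.
  repeat apply Cmult_neq_0; assumption.
Qed.

Theorem lemma3p1 (c d : R) :
  filterlim (stability_function c d) left_half_plane_infinity
    (locally (RtoC 0))
  <-> (c = - d /\ - d <> 0)%R.
Proof.
pose proof filterlim_Cinv_infinity as Hw.
pose proof filterlim_stage_factor as HG.
pose proof (quadratic_neq_0_infinity (1 / 6 + 4 * c - 5 / 2 * d)
  (1 / 2 * d - c)) as HQ.
pose proof left_half_plane_infinity_neq_0 as H0.
set (p := 1 / 6 + 4 * c + 1 / 2 * d).
set (q := 2 / 3 - 8 * c + 2 * d).
set (N := fun z => / z * / z + / z * (p + q * stage_factor z)
                   + (c + d * stage_factor z)).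
set (E := fun z => / z * / z - (1 / 6 + 4 * c - 5 / 2 * d) * / z
                   - (1 / 2 * d - c)).
assert (HN : filterlim N left_half_plane_infinity (locally (RtoC c + d))).
{ replace (RtoC c + d) with (0 * 0 + 0 * (p + q * 1) + (c + d * 1)) by ring.
  unfold N; climit. }
assert (HE : filterlim E left_half_plane_infinity (locally (c - 1 / 2 * d))).
{ replace (c - 1 / 2 * d)
    with (0 * 0 - (1 / 6 + 4 * c - 5 / 2 * d) * 0 - (1 / 2 * d - c)) by ring.
  unfold E; climit. }
(* That [E] is eventually nonzero comes from [HQ] and not from [HE], whose limit vanishes when c =
   d/2. *)
assert (HRE : left_half_plane_infinity (fun z =>
  stability_function c d z * E z = N z /\ E z <> 0)).
{ generalize (filter_and _ _ HQ H0).
  apply filter_imp; intros z [Hq Hz].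
  unfold stability_function; fold p q.
  replace (1 - (1 / 6 + 4 * c - 5 / 2 * d) * z - (1 / 2 * d - c) * z ^ 2)
    with (z * z * E z) in * by (unfold E; cfield).
  assert (Ez : E z <> 0) by (intros e; apply Hq; rewrite e; ring).
  split; [unfold N; cfield|assumption]. }
split.
- intros HR.
  assert (Hcd : RtoC c + d = 0).
  (* Limits along a proper filter are unique, and [N] tends both to c + d and, as the product of R
     and [E], to 0. *)
  { apply (filterlim_locally_unique (V := C_NormedModule)
      (F := left_half_plane_infinity) N); [exact HN|].
    apply filterlim_ext_loc with (fun z => stability_function c d z * E z).
    - generalize HRE; apply filter_imp; tauto.
    - replace (RtoC 0) with (0 * (c - 1 / 2 * d)) by ring; climit. }
  assert (Ecd : (c = - d)%R) by (apply (f_equal Re) in Hcd; simpl in Hcd; lra).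
  split; [exact Ecd|intros Hd].
  assert (d0 : d = 0%R) by lra.
  assert (c0 : c = 0%R) by lra.
  (* At c = d = 0 both [N] and [E] tend to 0, so the comparison moves up one power of z: [N z * z]
     tends to 1/6 + 2/3, yet it equals R (1/z - 1/6), which tends to 0. *)
  assert (H56 : / 6 + 2 / 3 = 0).
  { apply (filterlim_locally_unique (V := C_NormedModule)
      (F := left_half_plane_infinity) (fun z => N z * z)).
    - apply filterlim_ext_loc with
        (fun z => / z + (/ 6 + 2 / 3 * stage_factor z)).
      + generalize H0; apply filter_imp; intros z Hz.
        unfold N, p, q; rewrite c0, d0; cfield.
      + replace (/ 6 + 2 / 3) with (0 + (/ 6 + 2 / 3 * 1)) by ring; climit.
    - apply filterlim_ext_loc with
        (fun z => stability_function c d z * (/ z - / 6)).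
      + generalize (filter_and _ _ HRE H0).
        apply filter_imp; intros z [[<- _] Hz].
        unfold E; rewrite c0, d0; cfield.
      + replace (RtoC 0) with (0 * (0 - / 6)) by ring; climit. }
  apply (f_equal Re) in H56; simpl in H56; lra.
- intros [Hc Hd].
  assert (HL : c - 1 / 2 * d <> 0).
  { intros e; apply (f_equal Re) in e; simpl in e; lra. }
  apply filterlim_ext_loc with (fun z => N z * / E z).
  + generalize HRE; apply filter_imp; intros z [<- Ez]; cfield.
  + replace (RtoC 0) with ((RtoC c + d) * / (c - 1 / 2 * d)).
    * climit; now apply filterlim_Cinv.
    * replace (RtoC c + d) with (RtoC 0); [ring|].
      rewrite <- RtoC_plus; f_equal; lra.
Qed.
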